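(* Let $\beta_k=\sum_{j=0}^{k}\binom{k}{j}^2\binom{k+j}{j}$ for $k\in\mathbb{N}$. For any positive integer $n$, \[\sum_{k=0}^{n-1}(11k^2+13k+4)\beta_k\equiv0\pmod{2n^2},\] \[\sum_{k=0}^{n-1}(11k^2+9k+2)(-1)^k\beta_k\equiv0\pmod{2n^2},\] \[\sum_{k=0}^{n-1}(11k^3+7k^2-1)(-1)^k\beta_k\equiv0\pmod{n^2}.\]
   Context: The numbers $\beta_k$ are the Apéry numbers $\beta_k=\sum_{j=0}^{k}\binom{k}{j}^2\binom{k+j}{j}$. *)

(* Defs.v *)
From mathcomp Require Import all_boot all_order all_algebra.

Set Implicit Arguments.
Unset Strict Implicit.
Unset Printing Implicit Defensive.

Definition apery (k : nat) : nat :=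
  \sum_(0 <= j < k.+1) 'C(k, j) ^ 2 * 'C(k + j, j).

(* Main.v *)
(** The Apéry recurrence [(n+1)^2 b_(n+1) = (11n^2+11n+3) b_n + n^2 b_(n-1)],
    multiplied by [1], [(-1)^n] or [(-1)^n n] and summed by parts, evaluates each
    of the three sums in closed form as [n^2] times a combination of [b_n] and
    [b_(n-1)]. The extra factor 2 comes from the oddness of all [b_k]. *)
Require Import Defs.
From mathcomp Require Import all_boot all_order all_algebra.
From mathcomp Require Import ring lra.

Import Order.TTheory GRing.Theory Num.Theory.
Local Open Scope ring_scope.

Definition apery_term (n k : nat) : nat := ('C(n, k) ^ 2 * 'C(n + k, k))%N.

Lemma apery_term_small n k : (n < k)%N -> apery_term n k = 0%N.
Proof. by move=> ltnk; rewrite /apery_term bin_small. Qed.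

(** Lets three consecutive Apéry numbers be summed over one common range. *)
Lemma apery_widen n N :
  (n < N)%N -> apery n = (\sum_(0 <= k < N) apery_term n k)%N.
Proof.
move=> ltnN; rewrite (big_cat_nat (n := n.+1)) //=.
rewrite [X in (_ + X)%N]big1_seq ?addn0 // => k.
by rewrite mem_index_iota => /andP[_ /andP[ltnk _]]; apply: apery_term_small.
Qed.

(** First of four index shifts for binomials. Their factors are fractions, so the recurrence is
    first proved over [rat]. *)
Lemma bin_pred_l n k :
  'C(n, k)%:R = (n.+1%:R - k%:R) / n.+1%:R * 'C(n.+1, k)%:R :> rat.
Proof.
have n1_neq0 : n.+1%:R != 0 :> rat by rewrite pnatr_eq0.
rewrite mulrAC; apply: (canRL (mulfK n1_neq0)).
rewrite mulrC -natrM.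
case: (leqP k n.+1) => [lekn|ltnk].
  by rewrite -natrB // -natrM mul_bin_down.
by rewrite !bin_small ?muln0 ?mulr0 // ltnW.
Qed.

Lemma bin_succ_r n k :
  'C(n, k.+1)%:R = (n%:R - k%:R) / k.+1%:R * 'C(n, k)%:R :> rat.
Proof.
have k1_neq0 : k.+1%:R != 0 :> rat by rewrite pnatr_eq0.
rewrite mulrAC; apply: (canRL (mulfK k1_neq0)).
rewrite mulrC -natrM.
case: (leqP k n) => [lekn|ltnk]; first by rewrite -natrB // -natrM mul_bin_left.
by rewrite !bin_small ?muln0 ?mulr0 // ltnW.
Qed.

Lemma bin_succ_lr n k :
  'C(n.+1, k.+1)%:R = n.+1%:R / k.+1%:R * 'C(n, k)%:R :> rat.
Proof.
have k1_neq0 : k.+1%:R != 0 :> rat by rewrite pnatr_eq0.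
rewrite mulrAC; apply: (canRL (mulfK k1_neq0)).
by rewrite mulrC -!natrM mul_bin_diag.
Qed.

Lemma bin_pred_lr n k :
  'C(n, k)%:R = k.+1%:R / n.+1%:R * 'C(n.+1, k.+1)%:R :> rat.
Proof.
have n1_neq0 : n.+1%:R != 0 :> rat by rewrite pnatr_eq0.
rewrite mulrAC; apply: (canRL (mulfK n1_neq0)).
by rewrite mulrC -!natrM mul_bin_diag.
Qed.

(* Zeilberger certificate for the recurrence at index [n] *)
Definition apery_cert (n k : nat) : rat :=
  (k%:R ^+ 2 + 3 * (2 * n%:R + 1) * k%:R - 11 * n%:R ^+ 2 - 9 * n%:R - 2)
  * (apery_term n k)%:R.

(** The recurrence at index [m.+1], left side minus right side, applied to the summands; the shift
    avoids a predecessor. *)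
Definition apery_defect (m k : nat) : rat :=
  m.+2%:R ^+ 2 * (apery_term m.+2 k)%:R
  - (11 * m.+1%:R ^+ 2 + 11 * m.+1%:R + 3) * (apery_term m.+1 k)%:R
  - m.+1%:R ^+ 2 * (apery_term m k)%:R.

Lemma apery_defect0 m : apery_defect m 0 = apery_cert m.+1 0.
Proof.
rewrite /apery_defect /apery_cert /apery_term !bin0.
ring.
Qed.

Lemma apery_defectS m k :
  apery_defect m k.+1 = apery_cert m.+1 k.+1 - apery_cert m.+1 k.
Proof.
rewrite /apery_defect /apery_cert /apery_term !natrM.
(* every binomial is a rational multiple of 'C(m + 1, k) or 'C(m + k + 3, k + 1),
   with denominators that never vanish *)
rewrite (bin_pred_l m k.+1) (bin_succ_lr m.+1 k) (bin_succ_r m.+1 k).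
rewrite !addnS !addSn (bin_pred_l (m + k).+1 k.+1) (bin_pred_lr (m + k).+1 k).
rewrite (bin_pred_l (m + k).+2 k.+1).
set c := 'C(m.+1, k)%:R; set d := 'C((m + k).+3, k.+1)%:R.
field.
have [k_ge0 m_ge0] : 0 <= k%:R :> rat /\ 0 <= m%:R :> rat by rewrite !ler0n.
by apply/and4P; split; apply: lt0r_neq0; lra.
Qed.

Lemma apery_rec_rat m :
  m.+2%:R ^+ 2 * (apery m.+2)%:R =
  (11 * m.+1%:R ^+ 2 + 11 * m.+1%:R + 3) * (apery m.+1)%:R
  + m.+1%:R ^+ 2 * (apery m)%:R :> rat.
Proof.
have sum_defect N : \sum_(0 <= k < N.+1) apery_defect m k = apery_cert m.+1 N.
  elim: N => [|N IHN]; first by rewrite big_nat1 apery_defect0.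
  by rewrite big_nat_recr //= IHN apery_defectS addrC subrK.
(* The range up to [m.+2] contains all nonzero terms of the three sums, while the certificate at its
   end carries [apery_term m.+1 m.+2], which is zero. *)
have := sum_defect m.+2.
rewrite /apery_cert apery_term_small // mulr0 /apery_defect !sumrB -!mulr_sumr.
rewrite -!natr_sum -!apery_widen ?ltnS ?leqW // => /eqP.
by rewrite subr_eq0 subr_eq addrC => /eqP.
Qed.

Lemma apery_rec m :
  m.+2%:Z ^+ 2 * (apery m.+2)%:Z =
  (11 * m.+1%:Z ^+ 2 + 11 * m.+1%:Z + 3) * (apery m.+1)%:Z
  + m.+1%:Z ^+ 2 * (apery m)%:Z.
Proof.
apply: (@intr_inj rat); rewrite !(rmorphD, rmorphM, rmorphXn) /=.
exact: apery_rec_rat.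
Qed.

(** Both sides equal the multinomial (2j+r)! / (j! j! r!). This exposes a central binomial inside
    the Apéry summand. *)
Lemma bin_trinomial j r :
  ('C(j + r, j) * 'C(j + r + j, j) = 'C(j + r + j, j + j) * 'C(j + j, j))%N.
Proof.
have fact3_gt0 : (0 < j`! * j`! * r`!)%N by rewrite !muln_gt0 !fact_gt0.
apply/eqP; rewrite -(eqn_pmul2r fact3_gt0); apply/eqP.
have e1 := @bin_fact (j + r) j (leq_addr _ _).
have e2 := @bin_fact (j + r + j) j (leq_addl _ _).
have le3 : (j + j <= j + r + j)%N by rewrite leq_add2r leq_addr.
have e3 := bin_fact le3.
have e4 := @bin_fact (j + j) j (leq_addr _ _).
rewrite addKn in e1; rewrite addnK in e2; rewrite addKn in e4.
rewrite addnAC addKn -addnAC in e3.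
transitivity (j + r + j)`!.
  by rewrite -e2 -e1; ring.
by rewrite -e3 -e4; ring.
Qed.

(** Pascal's rule splits the central binomial into two terms that are equal by symmetry. *)
Lemma odd_bin_center j : odd 'C(j.+1 + j.+1, j.+1) = false.
Proof.
rewrite addSn binS -['C(_, j) in X in odd X]bin_sub ?leq_addr // addKn.
by rewrite addnn odd_double.
Qed.

Lemma odd_apery_term n k : odd (apery_term n k.+1) = false.
Proof.
case: (ltnP k n) => [ltkn|lenk]; last by rewrite apery_term_small.
(* Writing [n] as [k.+1 + (n - k.+1)] in one factor of the square and in the last binomial produces
   the trinomial product. *)
rewrite /apery_term expnS expn1 -mulnA -{2 3}(subnKC ltkn) bin_trinomial.
by rewrite !oddM odd_bin_center !andbF.
Qed.

(** Only the term at index 0, which is 1, is odd. *)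
Lemma odd_apery n : odd (apery n).
Proof.
rewrite (apery_widen n n.+1) // big_nat_recl // /apery_term !bin0 oddD /=.
apply: (big_ind (fun x => ~~ odd x)) => // [x y|k _].
  by rewrite oddD => /negPf-> /negPf->.
by rewrite odd_apery_term.
Qed.

(** In the increment of the right side, the recurrence replaces the [apery n.+2] term; the [apery n]
    terms then cancel and the summand at [n.+1] remains. *)
Lemma apery_sum1 n :
  \sum_(0 <= k < n.+1) (11 * k%:Z ^+ 2 + 13 * k%:Z + 4) * (apery k)%:Z
  = n.+1%:Z ^+ 2 * ((apery n.+1)%:Z + (apery n)%:Z).
Proof.
elim: n => [|n IHn].
  by rewrite big_nat1 /apery unlock.
rewrite big_nat_recr //= IHn [RHS]mulrDr apery_rec.
ring.
Qed.

(** The same telescoping; the minus sign in the closed form offsets the alternation, so the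
    [apery n] terms again cancel. *)
Lemma apery_sum2 n :
  \sum_(0 <= k < n.+1) (11 * k%:Z ^+ 2 + 9 * k%:Z + 2) * (-1) ^+ k * (apery k)%:Z
  = n.+1%:Z ^+ 2 * (-1) ^+ n * ((apery n.+1)%:Z - (apery n)%:Z).
Proof.
elim: n => [|n IHn].
  by rewrite big_nat1 /apery unlock.
rewrite big_nat_recr //= IHn [(-1) ^+ n.+1]exprS; move: ((-1) ^+ n) => s.
rewrite [RHS]mulrBr [_ * _ * (apery n.+2)%:Z]mulrAC apery_rec.
ring.
Qed.

Lemma apery_sum3 n :
  \sum_(0 <= k < n.+1)
     (11 * k%:Z ^+ 3 + 7 * k%:Z ^+ 2 - 1) * (-1) ^+ k * (apery k)%:Z
  = n.+1%:Z ^+ 2 * (-1) ^+ n * (n%:Z * (apery n.+1)%:Z - n.+1%:Z * (apery n)%:Z).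
Proof.
elim: n => [|n IHn].
  by rewrite big_nat1 /apery unlock.
rewrite big_nat_recr //= IHn [(-1) ^+ n.+1]exprS; move: ((-1) ^+ n) => s.
(* Regrouped so that the left side of [apery_rec] appears literally. *)
transitivity (n.+2%:Z ^+ 2 * n.+2%:Z * s * (apery n.+1)%:Z
              - n.+2%:Z ^+ 2 * (apery n.+2)%:Z * s * n.+1%:Z); last by ring.
by rewrite apery_rec; ring.
Qed.

Lemma eqz_mod0 (x d : int) : (d %| x)%Z -> (x = 0 %[mod d])%Z.
Proof. by move=> dvd; apply/eqP; rewrite eqz_mod_dvd subr0. Qed.

Theorem theorem1p1 (n : nat) (n_gt0 : (0 < n)%N) :
  [/\ (\sum_(0 <= k < n)
         (11 * k%:Z ^+ 2 + 13 * k%:Z + 4) * (apery k)%:Z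
       = 0 %[mod 2 * n%:Z ^+ 2])%Z,
      (\sum_(0 <= k < n)
         (11 * k%:Z ^+ 2 + 9 * k%:Z + 2) * (-1) ^+ k * (apery k)%:Z
       = 0 %[mod 2 * n%:Z ^+ 2])%Z
    & (\sum_(0 <= k < n)
         (11 * k%:Z ^+ 3 + 7 * k%:Z ^+ 2 - 1) * (-1) ^+ k * (apery k)%:Z
       = 0 %[mod n%:Z ^+ 2])%Z].
Proof.
case: n n_gt0 => [//|n] _.
have even_add : (2 %| (apery n.+1)%:Z + (apery n)%:Z)%Z.
  by rewrite -PoszD dvdzE /= dvdn2 oddD !odd_apery.
have even_sub : (2 %| (apery n.+1)%:Z - (apery n)%:Z)%Z.
  have -> : (apery n.+1)%:Z - (apery n)%:Z
            = (apery n.+1)%:Z + (apery n)%:Z - 2 * (apery n)%:Z by ring.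
  by rewrite rpredB // dvdz_mulr.
split; apply: eqz_mod0.
- by rewrite apery_sum1 mulrC dvdz_mul.
- by rewrite apery_sum2 [2 * _]mulrC dvdz_mul // dvdz_mulr.
- by rewrite apery_sum3 -mulrA dvdz_mulr.
Qed.
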